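(* Let $X_1,\dots,X_N$ be independent random variables uniformly distributed over $[0,1]$, let $L_N=L_N(X_1,\dots,X_N)$ and let $M$ be a median of $L_N$. Then for all $u>0$, $$P(L_N\ge M+u)\le2\exp\Big(-\frac{u^2}{4(M+u)}\Big),$$ $$P(L_N\le M-u)\le2\exp\Big(-\frac{u^2}{4M}\Big).$$
   Context: For points $x_1,\dots,x_N$ of $[0,1]$, $L_N(x_1,\dots,x_N)$ is the length of the longest increasing subsequence, i.e. the largest integer $p$ for which there exist $i_1<\cdots<i_p$ with $x_{i_1}\le\cdots\le x_{i_p}$. *)

(* Defs.v *)
From mathcomp Require Import all_boot all_order all_algebra.
From mathcomp Require Import all_classical all_reals all_analysis.

Set Implicit Arguments.
Unset Strict Implicit.
Unset Printing Implicit Defensive.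

Import Order.TTheory GRing.Theory Num.Theory.

Local Open Scope classical_set_scope.
Local Open Scope ring_scope.

(* The largest p for which there are i_1 < ... < i_p with
   x_{i_1} <= ... <= x_{i_p}.  Such a p is at most N, so bounding the maximum
   by N loses nothing; p = 0 always qualifies. *)
Definition lis_length (R : realType) (N : nat) (x : 'I_N -> R) : nat :=
  \max_(p < N.+1 | [exists s : p.-tuple 'I_N,
      sorted (fun i j : 'I_N => (i < j)%N) s &&
      sorted (fun a b : R => a <= b) [seq x i | i <- s]]) p.

Definition mutually_independent (d : measure_display) (T : measurableType d)
    (R : realType) (P : probability T R) (I : finType)
    (X : I -> {RV P >-> R}) : Prop :=
  forall (J : {set I}) (A : I -> set R),
    (forall i, i \in J -> measurable (A i)) ->
    P (\bigcap_(i in [set` J]) (X i @^-1` A i)) =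
      (\prod_(i in J) P (X i @^-1` A i))%E.

Definition uniform01 (d : measure_display) (T : measurableType d)
    (R : realType) (P : probability T R) (X : {RV P >-> R}) : Prop :=
  forall A : set R, measurable A ->
    distribution P X A = uniform_prob (@ltr01 R) A.

(* A median need not be unique, nor an integer when Y is integer-valued. *)
Definition is_median (d : measure_display) (T : measurableType d)
    (R : realType) (P : probability T R) (Y : T -> R) (M : R) : Prop :=
  ((2^-1)%:E <= P [set t | Y t <= M]%R)%E /\
  ((2^-1)%:E <= P [set t | M <= Y t]%R)%E.

(* Main.v *)
(* Talagrand's convex distance inequality on a finite space Om^n with uniform
   measure, by induction on n: above w, a vector for the fiber A_w (extended by
   0) and one for the projection B of A (extended by 1) are combined with weights
   l, 1 - l; Hoelder's inequality and the optimal l give the bound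
   (2 - r) / P(B) with r = P(A_w) / P(B), and averaging over w gives 1 / P(A).
   Testing the distance to A = {L <= a} against the indicator of a longest
   increasing subsequence yields
   P(L <= a) P(L >= b) <= exp (- (b - a)^2 / (4 b)), and the theorem follows with
   (a, b) = (M, M + u) and (M - u, M).  The uniform variables reduce to the finite
   case by cutting [0, 1] into K equal intervals: unless two variables fall in the
   same one, which has probability O(1 / K), L depends only on the indices. *)

Require Import Defs.
From mathcomp Require Import all_boot all_order all_algebra.
From mathcomp Require Import all_classical all_reals all_analysis.
From mathcomp Require Import ring lra zify.

Import Order.TTheory GRing.Theory Num.Theory.
Import numFieldNormedType.Exports.

Set Implicit Arguments.
Unset Strict Implicit.

Local Open Scope classical_set_scope.
Local Open Scope ring_scope.

(** * Exponential inequalities *)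

Lemma derive_ge0_le0 (R : realType) (f df : R -> R) (x : R) :
  (forall y, is_derive y (1 : R) f (df y)) ->
  (forall y, 0 <= y -> 0 <= df y) -> 0 <= x -> f 0 <= f x.
Proof.
move=> fE df0 x0.
have fd y : derivable f y (1 : R) by have := fE y.
apply: (@ger0_derive1_ndecry _ _ 0) => //.
- move=> y; rewrite in_itv/= andbT => y0.
  by rewrite derive1E derive_val df0 ?ltW.
- apply/continuous_subspaceT => y.
  by apply/differentiable_continuous/derivable1_diffP.
Qed.

(* Successive integration, starting from [1 - y <= expR (- y)]. *)
Lemma expRN_le_quadratic (R : realType) (y : R) : 0 <= y ->
  expR (- y) <= 1 - y + y ^+ 2 / 2.
Proof.
move=> y0; rewrite -subr_ge0.
pose f (z : R) := 1 - z + z ^+ 2 / 2 - expR (- z).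
have f0 : f 0 = 0 by rewrite /f oppr0 expR0; lra.
rewrite -[leRHS]/(f y) -f0.
apply: (@derive_ge0_le0 _ f (fun z => -1 + z + expR (- z))) => // z.
  rewrite /f; apply: is_derive_eq; rewrite /GRing.scale/=.
  by field.
move=> z0; have := expR_ge1Dx (- z); lra.
Qed.

Lemma expRN_ge_cubic (R : realType) (y : R) : 0 <= y ->
  1 - y + y ^+ 2 / 2 - y ^+ 3 / 6 <= expR (- y).
Proof.
move=> y0; rewrite -subr_ge0.
pose f (z : R) := expR (- z) - (1 - z + z ^+ 2 / 2 - z ^+ 3 / 6).
have f0 : f 0 = 0 by rewrite /f oppr0 expR0; lra.
rewrite -[leRHS]/(f y) -f0.
apply: (@derive_ge0_le0 _ f (fun z => 1 - z + z ^+ 2 / 2 - expR (- z))) => // z.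
  rewrite /f; apply: is_derive_eq; rewrite /GRing.scale/=.
  by field.
by move=> z0; have := @expRN_le_quadratic _ z z0; lra.
Qed.

(** With [s = - ln r] this is the interpolation bound at its optimal exponent. The exponentials are
    replaced by polynomials whose terms of degree 1 and 2 in [s] cancel, leaving a cubic margin. *)
Lemma expR_sum_le2 (R : realType) (s : R) : 0 <= s <= 2^-1 ->
  expR (s - s ^+ 2) + expR (- s) <= 2.
Proof.
move=> /andP[s0 s1].
have := @expRN_le_quadratic _ s s0.
set y := s - s ^+ 2.
have y0 : 0 <= y by rewrite /y; nra.
have y1 : y <= 4^-1 by rewrite /y; have := sqr_ge0 (s - 2^-1); nra.
have := @expRN_ge_cubic _ y y0.
set q := 1 - y + _ - _ => eq es.
have q0 : 0 < q by rewrite /q; nra.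
(* Since [q <= expR (- y)], [expR y] is at most [1 / q]. The cubic coefficient 1/2 leaves enough
   slack for the polynomial to dominate [1 / q] when [y <= 1/4]. *)
have ey : expR y <= 1 + y + y ^+ 2 / 2 + y ^+ 3 / 2.
  have : q * expR y <= 1.
    have := @expRxMexpNx_1 _ y; have := expR_gt0 y; nra.
  have : 1 <= q * (1 + y + y ^+ 2 / 2 + y ^+ 3 / 2).
    rewrite -subr_ge0 /q.
    have -> : (1 - y + y ^+ 2 / 2 - y ^+ 3 / 6) *
     (1 + y + y ^+ 2 / 2 + y ^+ 3 / 2) - 1 =
     y ^+ 3 * (1 / 3 - 5 / 12 * y + y ^+ 2 / 6 - y ^+ 3 / 12) by field.
    by rewrite mulr_ge0 ?exprn_ge0//; nra.
  move=> h1 h2; rewrite -(ler_pM2l q0); lra.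
apply: (le_trans (lerD ey es)).
have ys : y ^+ 3 <= s ^+ 3 by rewrite lerXn2r ?nnegrE// /y; nra.
have s3 : 0 <= s ^+ 3 by rewrite exprn_ge0.
rewrite -subr_ge0.
have -> : 2 - (1 + y + y ^+ 2 / 2 + y ^+ 3 / 2 + (1 - s + s ^+ 2 / 2)) =
  s ^+ 3 - s ^+ 4 / 2 - y ^+ 3 / 2 by rewrite /y; field.
have : s ^+ 4 <= s ^+ 3 / 2 by rewrite exprS; nra.
lra.
Qed.

(* The optimal exponent is [1 + 2 ln r], truncated at [0]. *)
Lemma exists_interpolation_exponent (R : realType) (r : R) : 0 < r <= 1 ->
  exists2 l : R, 0 <= l <= 1 & expR ((1 - l) ^+ 2 / 4 - l * ln r) <= 2 - r.
Proof.
move=> /andP[r0 r1]; have l0 : ln r <= 0 by rewrite ln_le0.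
have er : expR (ln r) = r by rewrite lnK.
have [lr|lr] := leP (- 2^-1) (ln r).
  exists (1 + 2 * ln r); first lra.
  have : expR (- ln r - (- ln r) ^+ 2) + expR (- - ln r) <= 2.
    by apply: expR_sum_le2; lra.
  rewrite opprK er.
  have -> : (1 - (1 + 2 * ln r)) ^+ 2 / 4 - (1 + 2 * ln r) * ln r =
    - ln r - (- ln r) ^+ 2 by field.
  lra.
exists 0; first lra.
have : expR (2^-1 - (2^-1) ^+ 2) + expR (- 2^-1) <= 2 :> R.
  by apply: expR_sum_le2; lra.
have -> : 2^-1 - (2^-1) ^+ 2 = (1 - 0) ^+ 2 / 4 - 0 * ln r :> R by field.
have : expR (ln r) < expR (- 2^-1) by rewrite ltr_expR.
by rewrite er; lra.
Qed.

Lemma expR_convex (R : realType) (l p q : R) : 0 <= l <= 1 ->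
  expR (l * p + (1 - l) * q) <= l * expR p + (1 - l) * expR q.
Proof.
move=> /andP[l0 l1].
have := @convex_expR _ (Itv01 l0 l1) p q.
by rewrite !convRE/=.
Qed.

(** * The convex distance inequality *)

(** Hoelder's inequality with exponents [1 / l] and [1 / (1 - l)], endpoints included: after
    normalising by [a] and [b], it is convexity of [expR] summed over [z]. *)
Lemma hoelder_sum_expR (R : realType) (Z : finType) (p q : Z -> R) (l a b : R) :
  0 <= l <= 1 -> 0 < a -> 0 < b ->
  \sum_z expR (p z) <= a -> \sum_z expR (q z) <= b ->
  \sum_z expR (l * p z + (1 - l) * q z) <= expR (l * ln a + (1 - l) * ln b).
Proof.
move=> l01 a0 b0 pa qb.
set e := expR (l * _ + _); have e0 : 0 < e by exact: expR_gt0.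
have H z : expR (l * p z + (1 - l) * q z) <=
    e * (l / a * expR (p z) + (1 - l) / b * expR (q z)).
  have -> : l * p z + (1 - l) * q z = (l * ln a + (1 - l) * ln b) +
     (l * (p z - ln a) + (1 - l) * (q z - ln b)) by ring.
  rewrite expRD ler_pM2l//; apply: (le_trans (expR_convex _ _ l01)).
  rewrite !expRB !lnK ?posrE//.
  by rewrite (mulrC (expR (p z))) (mulrC (expR (q z))) !mulrA.
apply: (le_trans (ler_sum _ (fun z _ => H z))).
rewrite -mulr_sumr big_split/= -!mulr_sumr -[leRHS]mulr1 ler_pM2l//.
move/andP: l01 => [l0 l1].
have la : l / a * (\sum_z expR (p z)) <= l.
  by rewrite -mulrA ler_piMr// ler_pdivrMl// mulr1.
have lb : (1 - l) / b * (\sum_z expR (q z)) <= 1 - l.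
  by rewrite -mulrA ler_piMr ?subr_ge0// ler_pdivrMl// mulr1.
lra.
Qed.

Lemma big_tupleS (R : nmodType) (Om : finType) n (F : n.+1.-tuple Om -> R) :
  \sum_x F x = \sum_w \sum_z F (cons_tuple w z).
Proof.
rewrite pair_bigA/=.
rewrite (reindex (fun wz : Om * n.-tuple Om => cons_tuple wz.1 wz.2))//.
exists (fun x => (thead x, [tuple of behead x])) => [[w z]|x] _ /=.
  by congr pair; apply/val_inj.
by rewrite [RHS]tuple_eta; apply/val_inj.
Qed.

(* Expresses that [v] dominates a convex combination of the vectors
   [(x_i != y_i)_i], [y \in A]; the squared norm of [v] therefore bounds from
   above the square of Talagrand's convex distance from [x] to [A]. *)
Definition convex_dist_witness {R : realType} {Om : finType} {n}
    (A : {set n.-tuple Om}) (x : n.-tuple Om) (v : 'I_n -> R) :=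
  forall alpha : 'I_n -> R, (forall i, 0 <= alpha i) ->
  exists2 y, y \in A &
    \sum_i alpha i * (tnth x i != tnth y i)%:R <= \sum_i alpha i * v i.

Section ConvexDistWitness.
Context {R : realType} {Om : finType}.
Implicit Types (n : nat) (w : Om).

(** For fixed [alpha] the right-hand side is affine in the vector, so the point of [A] found for the
    smaller of the two values also serves the combination. *)
Lemma convex_dist_witness_convex n (A : {set n.-tuple Om}) x
    (v1 v2 : 'I_n -> R) (l : R) : 0 <= l <= 1 ->
  convex_dist_witness A x v1 -> convex_dist_witness A x v2 ->
  convex_dist_witness A x (fun i => l * v1 i + (1 - l) * v2 i).
Proof.
move=> /andP[l0 l1] H1 H2 alpha a0.
have -> : \sum_i alpha i * (l * v1 i + (1 - l) * v2 i) =
  l * (\sum_i alpha i * v1 i) + (1 - l) * (\sum_i alpha i * v2 i).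
  by rewrite !mulr_sumr -big_split/=; apply: eq_bigr => i _; ring.
have [y1 y1A le1] := H1 alpha a0; have [y2 y2A le2] := H2 alpha a0.
have [v12|v21] := leP (\sum_i alpha i * v1 i) (\sum_i alpha i * v2 i).
  by exists y1 => //; apply: (le_trans le1); nra.
by exists y2 => //; apply: (le_trans le2); nra.
Qed.

Definition fcons n (c : R) (v : 'I_n -> R) (i : 'I_n.+1) : R :=
  if unlift ord0 i is Some j then v j else c.

Lemma fcons0 n c (v : 'I_n -> R) : fcons c v ord0 = c.
Proof. by rewrite /fcons unlift_none. Qed.

Lemma fconsS n c (v : 'I_n -> R) i : fcons c v (lift ord0 i) = v i.
Proof. by rewrite /fcons liftK. Qed.

Definition fiber n (A : {set n.+1.-tuple Om}) w : {set n.-tuple Om} :=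
  [set z | cons_tuple w z \in A].

Definition shadow n (A : {set n.+1.-tuple Om}) : {set n.-tuple Om} :=
  [set z | [exists w, cons_tuple w z \in A]].

(** The point of [A] found here also starts with [w], so the new coordinate costs 0. *)
Lemma convex_dist_witness_fiber n (A : {set n.+1.-tuple Om}) w z v :
  convex_dist_witness (fiber A w) z v ->
  convex_dist_witness A (cons_tuple w z) (fcons 0 v).
Proof.
move=> H alpha a0.
have [y yA le1] := H (fun i => alpha (lift ord0 i)) (fun i => a0 _).
exists (cons_tuple w y); first by move: yA; rewrite inE.
rewrite !big_ord_recl !tnth0 eqxx fcons0 !mulr0 !add0r.
under eq_bigr do rewrite !tnthS.
by under [leRHS]eq_bigr do rewrite fconsS.
Qed.

(** Lifting a point of the shadow to [A] gives no control over its first coordinate, whence the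
    entry 1. *)
Lemma convex_dist_witness_shadow n (A : {set n.+1.-tuple Om}) w z v :
  convex_dist_witness (shadow A) z v ->
  convex_dist_witness A (cons_tuple w z) (fcons 1 v).
Proof.
move=> H alpha a0.
have [y yA le1] := H (fun i => alpha (lift ord0 i)) (fun i => a0 _).
move: yA; rewrite inE => /existsP[w' yA]; exists (cons_tuple w' y) => //.
rewrite !big_ord_recl !tnth0 fcons0 lerD//.
  by rewrite ler_wpM2l// lern1 leq_b1.
under eq_bigr do rewrite !tnthS.
by under [leRHS]eq_bigr do rewrite fconsS.
Qed.

Lemma convex_dist_witness_cons n (A : {set n.+1.-tuple Om}) w z s t (l : R) :
  0 <= l <= 1 ->
  convex_dist_witness (fiber A w) z s -> convex_dist_witness (shadow A) z t ->
  convex_dist_witness A (cons_tuple w z)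
    (fcons (1 - l) (fun i => l * s i + (1 - l) * t i)).
Proof.
move=> l01 /convex_dist_witness_fiber Hs /(convex_dist_witness_shadow w) Ht.
move=> alpha a0.
have [y yA le1] := convex_dist_witness_convex l01 Hs Ht a0.
exists y => //; apply: (le_trans le1); rewrite le_eqVlt; apply/orP; left.
apply/eqP; apply: eq_bigr => i _; congr (_ * _).
have [j ->|->] := unliftP ord0 i; first by rewrite !fconsS.
by rewrite !fcons0; ring.
Qed.

End ConvexDistWitness.

Section Talagrand.
Context {R : realType} {Om : finType}.
Implicit Types (n : nat) (w : Om).

Lemma sum_sqr_fcons_le n (s t : 'I_n -> R) (l : R) : 0 <= l <= 1 ->
  \sum_i fcons (1 - l) (fun i => l * s i + (1 - l) * t i) i ^+ 2 <=
  l * (\sum_i s i ^+ 2) + (1 - l) * (\sum_i t i ^+ 2) + (1 - l) ^+ 2.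
Proof.
move=> /andP[l0 l1]; rewrite big_ord_recl fcons0 addrC lerD2r.
rewrite !mulr_sumr -big_split/=; apply: ler_sum => i _; rewrite fconsS.
rewrite -subr_ge0 [leRHS](_ : _ = l * (1 - l) * (s i - t i) ^+ 2); last by ring.
by rewrite mulr_ge0 ?sqr_ge0// mulr_ge0// subr_ge0.
Qed.

(** Hoelder gives [a ^ l * b ^ (1 - l)], that is, [b * (b / a) ^ (- l)]. In the induction [b / a] is
    the ratio of the sizes of fiber and shadow. *)
Lemma sum_expR_fcons_le n (s t : n.-tuple Om -> 'I_n -> R) (l a b : R) :
  0 <= l <= 1 -> 0 < a -> 0 < b ->
  \sum_z expR ((\sum_i s z i ^+ 2) / 4) <= a ->
  \sum_z expR ((\sum_i t z i ^+ 2) / 4) <= b ->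
  \sum_z expR
     ((\sum_i fcons (1 - l) (fun i => l * s z i + (1 - l) * t z i) i ^+ 2) / 4)
  <= b * expR ((1 - l) ^+ 2 / 4 - l * ln (b / a)).
Proof.
move=> l01 a0 b0 sa tb.
pose p z := (\sum_i s z i ^+ 2) / 4; pose q z := (\sum_i t z i ^+ 2) / 4.
apply: (@le_trans _ _ (\sum_z expR ((1 - l) ^+ 2 / 4) *
    expR (l * p z + (1 - l) * q z))).
  apply: ler_sum => z _; rewrite -expRD ler_expR.
  by have := sum_sqr_fcons_le (s z) (t z) l01; rewrite /p /q; lra.
rewrite -mulr_sumr.
rewrite [leRHS](_ : _ =
    expR ((1 - l) ^+ 2 / 4) * expR (l * ln a + (1 - l) * ln b)).
  by rewrite ler_pM2l ?expR_gt0//; exact: hoelder_sum_expR.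
rewrite -{1}(lnK (x := b)) ?posrE// -!expRD ln_div ?posrE//; congr expR; ring.
Qed.

Lemma card_fibers n (A : {set n.+1.-tuple Om}) :
  #|A|%:R = \sum_w #|fiber A w|%:R :> R.
Proof.
have cardE (Z : finType) (C : {set Z}) : #|C|%:R = \sum_z (z \in C)%:R :> R.
  by rewrite -sum1_card natr_sum big_mkcond/=; apply: eq_bigr => z _; case: ifP.
rewrite cardE big_tupleS; apply: eq_bigr => w _; rewrite cardE.
by apply: eq_bigr => z _; rewrite inE.
Qed.

Lemma fiber_sub_shadow n (A : {set n.+1.-tuple Om}) w :
  fiber A w \subset shadow A.
Proof.
by apply/fintype.subsetP => z; rewrite !inE => zA; apply/existsP; exists w.
Qed.

Lemma shadow_neq0 n (A : {set n.+1.-tuple Om}) :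
  A != finset.set0 -> shadow A != finset.set0.
Proof.
move=> /set0Pn[x xA]; apply/set0Pn; exists [tuple of behead x].
rewrite inE; apply/existsP; exists (thead x).
by rewrite (_ : cons_tuple _ _ = x)// [RHS]tuple_eta; exact/val_inj.
Qed.

(** The bound [1 / P(A)] on the expectation, multiplied by the number of points. Asking for some
    witness at each [x] avoids defining the distance as an infimum. *)
Theorem convex_dist_inequality n (A : {set n.-tuple Om}) : A != finset.set0 ->
  exists2 v : n.-tuple Om -> 'I_n -> R, forall x, convex_dist_witness A x (v x) &
    \sum_x expR ((\sum_i v x i ^+ 2) / 4) <= (#|Om| ^ n)%:R ^+ 2 / #|A|%:R.
Proof.
elim: n A => [|n IHn] A A0.
  exists (fun _ _ => 0) => [x alpha _|].
    by case/set0Pn: A0 => y yA; exists y; rewrite // !big_ord0.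
  have A1 : #|A| = 1%N.
    apply/eqP; rewrite eqn_leq card_gt0 A0 andbT.
    by rewrite (leq_trans (max_card _))// card_tuple expn0.
  rewrite A1 expn0 expr1n divr1 (eq_bigr (fun=> 1)).
    by rewrite sumr_const card_tuple expn0.
  by move=> x _; rewrite big_ord0 mul0r expR0.
have B0 := shadow_neq0 A0.
have [t tP tS] := IHn _ B0.
have b0 : 0 < #|shadow A|%:R :> R by rewrite ltr0n card_gt0.
have K0 : (0 < #|Om|)%N.
  by case/set0Pn: A0 => x _; apply/card_gt0P; exists (thead x).
set Q := _%:R ^+ 2 in tS.
have Q0 : 0 < Q by rewrite exprn_gt0// ltr0n expn_gt0 K0.
set b : R := #|shadow A|%:R in tS b0.
have Qb0 : 0 < Q / b by rewrite divr_gt0.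
have H w : exists u : n.-tuple Om -> 'I_n.+1 -> R,
    (forall z, convex_dist_witness A (cons_tuple w z) (u z)) /\
    \sum_z expR ((\sum_i u z i ^+ 2) / 4) <= Q / b * (2 - #|fiber A w|%:R / b).
  (* For an empty fiber ([r = 0]) only the shadow is available; the entry 1 costs a factor
     [expR (1/4)], at most 2 by [expR_sum_le2] at [s = 1/2]. *)
  have [Aw0|Aw0] := eqVneq (fiber A w) finset.set0.
    exists (fun z => fcons 1 (t z)); split=> [z|].
      exact: convex_dist_witness_shadow.
    rewrite Aw0 cards0 mul0r subr0.
    apply: (@le_trans _ _ (expR 4^-1 * (Q / b))).
      apply: (le_trans _ (ler_wpM2l (expR_ge0 _) tS)).
      rewrite mulr_sumr ler_sum// => z _; rewrite -expRD ler_expR.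
      rewrite big_ord_recl fcons0 expr1n mulrDl mul1r lerD2l.
      by under eq_bigr do rewrite fconsS.
    rewrite mulrC ler_pM2l//.
    have := @expR_sum_le2 R 2^-1; have := @expR_ge0 R (- 2^-1).
    rewrite (_ : 2^-1 - 2^-1 ^+ 2 = 4^-1); last by field.
    by move=> e0 /(_ _)/wrap[|]; lra.
  have [s sP sS] := IHn _ Aw0.
  have a0 : 0 < #|fiber A w|%:R :> R by rewrite ltr0n card_gt0.
  set a : R := #|fiber A w|%:R in sS a0 *.
  have ab : a / b <= 1.
    by rewrite ler_pdivrMr// mul1r ler_nat subset_leq_card// fiber_sub_shadow.
  have [|l l01 lP] := @exists_interpolation_exponent R (a / b).
    by rewrite divr_gt0.
  exists (fun z => fcons (1 - l) (fun i => l * s z i + (1 - l) * t z i)).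
  split=> [z|]; first exact: convex_dist_witness_cons.
  apply: (le_trans (sum_expR_fcons_le l01 _ Qb0 sS tS)); first by rewrite divr_gt0.
  rewrite ler_pM2l// (_ : Q / b / (Q / a) = a / b)//.
  by field; rewrite !gt_eqF.
have [u uP] := choice H.
exists (fun x => u (thead x) [tuple of behead x]) => [x|].
  have := (uP (thead x)).1 [tuple of behead x].
  by rewrite (_ : cons_tuple _ _ = x)// [RHS]tuple_eta; exact/val_inj.
rewrite big_tupleS.
apply: (@le_trans _ _ (\sum_w Q / b * (2 - #|fiber A w|%:R / b))).
  apply: ler_sum => w _; apply: le_trans (uP w).2; rewrite le_eqVlt.
  apply/orP; left; apply/eqP; apply: eq_bigr => z _.
  have bz : z = [tuple of behead (cons_tuple w z)] by exact/val_inj.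
  by rewrite [in RHS]bz.
rewrite -mulr_sumr sumrB -mulr_suml -card_fibers.
have A0' : 0 < #|A|%:R :> R by rewrite ltr0n card_gt0.
rewrite expnS natrM exprMn -/Q; set K : R := #|Om|%:R; set m : R := #|A|%:R in A0' *.
have -> : \sum_(w : Om) 2 = 2 * K by rewrite sumr_const mulr_natr.
(* The sum over [w] is [Q / b * (2 * K - m / b)]; its gap to the target is a perfect square, by
   [x * (2 - x) <= 1] with [x = m / (b * K)]. *)
rewrite -subr_ge0 (_ : _ - _ = Q / m * (K - m / b) ^+ 2).
  by apply: mulr_ge0; [apply: divr_ge0; exact: ltW|exact: sqr_ge0].
by field; rewrite !gt_eqF.
Qed.

End Talagrand.

(** * Increasing subsequences *)

Section LongestIncreasingSubsequence.
Context {R : realType} {N : nat}.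
Implicit Types (x y : 'I_N -> R) (s : seq 'I_N).

(** Both sortedness conditions of [lis_length] are merged into one transitive relation, so that
    filtering preserves increasing subsequences. *)
Definition incr x : rel 'I_N := fun i j => (i < j)%N && (x i <= x j).

Lemma incr_trans x : transitive (incr x).
Proof.
move=> j i k /andP[ij xij] /andP[jk xjk]; apply/andP; split.
  exact: ltn_trans jk.
exact: le_trans xjk.
Qed.

Lemma sorted_incr x s : sorted (incr x) s =
  sorted (fun i j : 'I_N => (i < j)%N) s &&
  sorted (fun a b : R => a <= b) [seq x i | i <- s].
Proof. by rewrite sorted_map -sorted_relI. Qed.

Lemma incr_uniq x s : sorted (incr x) s -> uniq s.
Proof.
by apply: sorted_uniq; [exact: incr_trans|move=> i; rewrite /incr ltnn].
Qed.

Lemma size_le_lis_length x s : sorted (incr x) s -> (size s <= lis_length x)%N.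
Proof.
move=> sx.
have sN : (size s < N.+1)%N.
  rewrite ltnS -[leqRHS]card_ord; have /card_uniqP <- := incr_uniq sx.
  exact: max_card.
rewrite /lis_length; apply: (leq_bigmax_cond (Ordinal sN)) => /=.
by apply/existsP; exists (in_tuple s); rewrite -sorted_incr.
Qed.

Lemma lis_length_attained x :
  exists2 s, sorted (incr x) s & size s = lis_length x.
Proof.
have [|p /existsP[s sx] e] := @eq_bigmax_cond _
  [pred p : 'I_N.+1 | [exists s : p.-tuple 'I_N,
      sorted (fun i j : 'I_N => (i < j)%N) s &&
      sorted (fun a b : R => a <= b) [seq x i | i <- s]]] (fun p => p : nat).
  by apply/card_gt0P; exists ord0; rewrite inE; apply/existsP; exists [tuple].
by exists s; rewrite ?sorted_incr// size_tuple -e.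
Qed.

Lemma lis_length_mono x y :
  (forall i j, x i <= x j -> y i <= y j) -> (lis_length x <= lis_length y)%N.
Proof.
move=> xy; have [s sx <-] := lis_length_attained x.
apply: size_le_lis_length; apply: sub_sorted sx => i j /andP[ij xij].
by apply/andP; split=> //; exact: xy.
Qed.

(** Only the order pattern matters: this yields measurability and lets bucket indices replace the
    variables. *)
Lemma lis_length_order x y :
  (forall i j, (x i <= x j) = (y i <= y j)) -> lis_length x = lis_length y.
Proof.
by move=> xy; apply/eqP; rewrite eqn_leq !lis_length_mono// => i j; rewrite xy.
Qed.

(** The entries of [s] at which [x] and [y] agree form an increasing subsequence for [y]. *)
Lemma size_le_lis_length_count x y s : sorted (incr x) s ->
  (size s <= lis_length y + count (fun i => x i != y i) s)%N.
Proof.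
move=> sx; rewrite -(count_predC (fun i => x i == y i) s) leq_add2r -size_filter.
apply: size_le_lis_length.
have sf := sorted_filter (@incr_trans x) (fun i => x i == y i) sx.
apply: (sub_in_sorted (P := [pred i | x i == y i]) (e := incr x)) sf.
  by move=> i j /eqP xi /eqP xj; rewrite /incr xi xj.
by apply/allP => i; rewrite mem_filter => /andP[].
Qed.

End LongestIncreasingSubsequence.

(** * Concentration on finite product spaces *)

Section FiniteConcentration.
Context {R : realType} {Om : finType} (phi : Om -> R) {N : nat}.

Definition tuple_lis (x : N.-tuple Om) : nat := lis_length (fun i => phi (tnth x i)).

(* Testing [v] against the indicator of a longest increasing subsequence of [x]:
   of its entries, at most [a] can be kept in a point of [A]. *)
Lemma sum_sqr_convex_dist_witness (A : {set N.-tuple Om}) x (v : 'I_N -> R)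
    (a b : R) : 0 <= a -> a < b ->
  (forall y, y \in A -> (tuple_lis y)%:R <= a) -> b <= (tuple_lis x)%:R ->
  convex_dist_witness A x v -> (b - a) ^+ 2 / b <= \sum_i v i ^+ 2.
Proof.
move=> a0 ab Aa bx xAv; have b0 : 0 < b by exact: le_lt_trans ab.
have [s sx sl] := lis_length_attained (fun i => phi (tnth x i)).
rewrite -[tuple_lis x]sl in bx; set k : R := (size s)%:R in bx.
have su := incr_uniq sx.
have [|y yA] := xAv (fun i => (i \in s)%:R); first by move=> i; exact: ler0n.
have ind (F : 'I_N -> R) : \sum_i (i \in s)%:R * F i = \sum_(i <- s) F i.
  rewrite [RHS]big_uniq// [RHS]big_mkcond/=; apply: eq_bigr => i _.
  by case: (i \in s); rewrite ?mul1r ?mul0r.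
rewrite !ind => yv.
have kv : k - a <= \sum_(i <- s) v i.
  apply: le_trans yv; rewrite lerBlDl -natr_sum.
  apply: (le_trans _ (lerD (Aa _ yA) (lexx _))); rewrite -natrD ler_nat.
  apply: (leq_trans (size_le_lis_length_count (fun i => phi (tnth y i)) sx)).
  rewrite leq_add2l -sum1_count big_mkcond/=; apply: leq_sum => i _.
  by have [->|] := eqVneq (tnth x i) (tnth y i); [rewrite eqxx|case: ifP].
(* Instead of Cauchy-Schwarz, the tangent bound [v ^ 2 >= 2 * c * v - c ^ 2] is summed over [s].
   This [c] is optimal for [k = b], and as [c <= 1] the resulting bound increases with [k]. *)
pose c := (b - a) / b.
have c0 : 0 <= c by apply: divr_ge0; [rewrite subr_ge0|]; exact: ltW.
have c1 : c <= 1 by rewrite ler_pdivrMr// mul1r lerBlDr lerDl.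
have cb : c * b = b - a by rewrite /c divfK ?gt_eqF.
apply: (@le_trans _ _ (\sum_(i <- s) (2 * c * v i - c ^+ 2))).
  rewrite sumrB -mulr_sumr big_const_seq count_predT iter_addr_0 -mulr_natr -/k.
  have -> : (b - a) ^+ 2 / b = c * (b - a) by rewrite /c; field; rewrite gt_eqF.
  have h1 : 0 <= c * (\sum_(i <- s) v i - (k - a)) by rewrite mulr_ge0 ?subr_ge0.
  have h2 : 0 <= c * (2 - c) * (k - b).
    by rewrite mulr_ge0 ?subr_ge0// mulr_ge0// subr_ge0 (le_trans c1)// ler1n.
  have h3 : c * (c * b) = c * (b - a) by rewrite cb.
  lra.
rewrite [leLHS]big_uniq// [leLHS]big_mkcond/=; apply: ler_sum => i _.
have := sqr_ge0 (v i - c); have := sqr_ge0 (v i); case: ifP => _ //; nra.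
Qed.

Lemma tuple_lis_concentration (a b : R) : 0 <= a -> a < b ->
  #|[set x : N.-tuple Om | (tuple_lis x)%:R <= a]%SET|%:R *
  #|[set x : N.-tuple Om | b <= (tuple_lis x)%:R]%SET|%:R <=
  (#|Om| ^ N)%:R ^+ 2 * expR (- ((b - a) ^+ 2 / (4 * b))).
Proof.
move=> a0 ab; set A := [set x | _]%SET; set U := [set x | b <= _]%SET.
have b0 : 0 < b by exact: le_lt_trans ab.
have [->|A0] := eqVneq A finset.set0.
  by rewrite cards0 mul0r mulr_ge0 ?sqr_ge0 ?expR_ge0.
have [v vP vS] := convex_dist_inequality (R := R) A0.
have A0' : 0 < #|A|%:R :> R by rewrite ltr0n card_gt0.
rewrite expRN ler_pdivlMr ?expR_gt0// -mulrA mulrC -ler_pdivlMr//.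
(* Markov's inequality: terms outside [U] are dropped, and those in [U] are bounded below. *)
apply: le_trans vS; rewrite -sum1_card natr_sum mulr_suml big_mkcond/=.
apply: ler_sum => x _; case: ifP => [|_]; last exact: expR_ge0.
rewrite inE => bx; rewrite mul1r ler_expR.
have := sum_sqr_convex_dist_witness a0 ab _ bx (vP x).
move=> /(_ _)/wrap[|]; first by move=> y; rewrite inE.
by rewrite (_ : _ / (4 * b) = (b - a) ^+ 2 / b / 4); [lra|field; rewrite gt_eqF].
Qed.

End FiniteConcentration.

(** * Discretisation *)

Section Bucket.
Context {R : realType} (K : nat) (K_gt0 : (0 < K)%N).

(** Half-open, hence disjoint. Those with [k < K] miss the point 1, which is harmless because only
    their probabilities are summed. *)
Definition bucket (k : nat) : set R := `[k%:R / K%:R, k.+1%:R / K%:R[.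

Let K0 : 0 < K%:R :> R. Proof. by rewrite ltr0n. Qed.

Lemma bucket_mono k l (x y : R) :
  bucket k x -> bucket l y -> x <= y -> (k <= l)%N.
Proof.
rewrite /bucket/= !in_itv/= => /andP[kx _] /andP[_ yl] xy.
have := le_lt_trans kx (le_lt_trans xy yl).
by rewrite ltr_pM2r ?invr_gt0// ltr_nat.
Qed.

Lemma bucket_inj k l (x : R) : bucket k x -> bucket l x -> k = l.
Proof.
move=> kx lx; apply/eqP; rewrite eqn_leq.
by rewrite (bucket_mono kx lx)// (bucket_mono lx kx).
Qed.

Lemma measurable_bucket k : measurable (bucket k).
Proof. exact: measurable_itv. Qed.

Lemma uniform_prob_bucket k : (k < K)%N ->
  uniform_prob (@ltr01 R) (bucket k) = (K%:R^-1)%:E.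
Proof.
move=> kK; rewrite /uniform_prob.
rewrite (eq_integral (cst 1%E)).
  rewrite integral_cst; last exact: measurable_bucket.
  rewrite mul1e; transitivity (lebesgue_measure (bucket k : set R)) => //.
  rewrite /bucket lebesgue_measure_itv/= lte_fin ltr_pM2r ?invr_gt0// ltr_nat ltnSn.
  by rewrite -EFinB -mulrBl -natrB// subSnn mul1r.
move=> x; rewrite inE /bucket/= in_itv/= => /andP[kx xk].
rewrite /uniform_pdf subr0 invr1 ifT//; apply/andP; split.
  by apply: le_trans kx; rewrite divr_ge0.
apply: (le_trans (ltW xk)); rewrite ler_pdivrMr// mul1r ler_nat//.
Qed.

End Bucket.

(** The ratio is the probability that [N] draws among [K] are distinct. It gains a factor
    [1 - n / K] at each step, and [n ^ 2 + n <= (n + 1) ^ 2]; for [K < N] the left side is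
    nonpositive. *)
Lemma ffact_ge_expn (R : realFieldType) (N K : nat) : (0 < K)%N ->
  1 - (N ^ 2)%:R / K%:R <= (K ^_ N)%:R / (K ^ N)%:R :> R.
Proof.
move=> K0; have K0' : 0 < K%:R :> R by rewrite ltr0n.
have KN0 n : 0 < (K ^ n)%:R :> R by rewrite ltr0n expn_gt0 K0.
have [KN|NK] := ltnP K N.
  apply: (@le_trans _ _ 0); last by rewrite divr_ge0 ?ler0n.
  rewrite subr_le0 ler_pdivlMr// mul1r ler_nat.
  by rewrite -mulnn (leq_trans (ltnW KN))// leq_pmulr// (leq_ltn_trans _ KN).
elim: N NK => [|n IHn] nK.
  by rewrite exp0n// mul0r subr0 ffactn0 expn0 divr1.
have := IHn (ltnW nK); set d : R := _%:R / (K ^ n)%:R => dn.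
have d1 : d <= 1.
  rewrite /d ler_pdivrMr// mul1r ler_nat ffact_prod.
  rewrite -[X in (_ <= _ ^ X)%N]card_ord -prod_nat_const.
  by apply: leq_prod => i _; exact: leq_subr.
have d0 : 0 <= d by rewrite /d divr_ge0 ?ler0n.
have -> : (K ^_ n.+1)%:R / (K ^ n.+1)%:R = d * (1 - n%:R / K%:R) :> R.
  rewrite ffactnSr expnSr !natrM (natrB _ (ltnW nK)) /d.
  by field; rewrite !gt_eqF.
have n0 : 0 <= n%:R / K%:R :> R by rewrite divr_ge0 ?ler0n.
have : (n ^ 2)%:R / K%:R + n%:R / K%:R <= (n.+1 ^ 2)%:R / K%:R :> R.
  by rewrite -mulrDl ler_pM2r ?invr_gt0// -natrD ler_nat !expnS !expn0; lia.
nra.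
Qed.

(** * Cells of the discretised cube *)

Section Cells.
Context {d : measure_display} {T : measurableType d} {R : realType}.
Context (P : probability T R) (N : nat) (X : 'I_N -> {RV P >-> R}).

(** There are finitely many comparison patterns, and [Q] is the union of the events on which a given
    pattern occurs, each a finite intersection of comparison events. *)
Lemma measurable_order_invariant (Q : set T) :
  (forall t t', (forall i j, (X i t <= X j t) = (X i t' <= X j t')) ->
    Q t -> Q t') -> measurable Q.
Proof.
move=> QX.
pose pat t : {ffun 'I_N * 'I_N -> bool} := [ffun p => X p.1 t <= X p.2 t].
have -> : Q = \bigcup_(c in pat @` Q)
    \bigcap_(p in setT) ((fun t => X p.1 t <= X p.2 t) @^-1` [set c p]).
  apply/seteqP; split=> [t Qt|t [_ [t' Qt' <-]] Ht].
    by exists (pat t); [exists t|move=> p _ /=; rewrite ffunE].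
  apply: QX Qt' => i j; have := Ht (i, j) I => /=.
  by rewrite ffunE.
apply: fin_bigcup_measurable => [|c _]; first exact: finite_finset.
apply: fin_bigcap_measurable => [|p _]; first exact: finite_finset.
rewrite -[X in measurable X]setTI.
by apply: (@measurable_realfun.measurable_fun_ler _ _ _ setT (X p.1) (X p.2)).
Qed.

Context (K : nat) (K_gt0 : (0 < K)%N).

(** Indexed by the full finite set so that [mutually_independent] applies verbatim. *)
Definition cell (k : N.-tuple 'I_K) : set T :=
  \bigcap_(i in [set` (finset.setT : {set 'I_N})]) (X i @^-1` bucket K (tnth k i)).

Lemma cellP k t : cell k t <-> forall i, bucket K (tnth k i) (X i t).
Proof.
split=> [H i|H i _]; last exact: H.
by apply: H; rewrite /= inE.
Qed.

Lemma measurable_cell k : measurable (cell k).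
Proof.
apply: fin_bigcap_measurable => [|i _]; first exact: finite_finset.
by apply: measurable_funPTI; exact: measurable_bucket.
Qed.

Lemma trivIset_cell (D : set (N.-tuple 'I_K)) : trivIset D cell.
Proof.
move=> k l _ _ [t [/cellP kt /cellP lt]]; apply: eq_from_tnth => i.
by apply/val_inj; exact: bucket_inj (kt i) (lt i).
Qed.

(** Bucket indices determine the order except inside a common bucket, which [uniq k] allows only for
    [i = j]. *)
Lemma cell_order (k : N.-tuple 'I_K) t : uniq k -> cell k t ->
  forall i j, (X i t <= X j t) = (tnth k i <= tnth k j)%N.
Proof.
move=> ku /cellP kt i j; apply/idP/idP => [|kij].
  exact: (bucket_mono K_gt0 (kt i) (kt j)).
rewrite leNgt; apply/negP => ji.
have kji := bucket_mono K_gt0 (kt j) (kt i) (ltW ji).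
have : tnth k i = tnth k j by apply/val_inj/eqP; rewrite eqn_leq kij kji.
by move=> /(tuple_uniqP k ku) ij; rewrite ij ltxx in ji.
Qed.

Lemma lis_length_cell (k : N.-tuple 'I_K) t : uniq k -> cell k t ->
  lis_length (fun i => X i t) = tuple_lis (fun a : 'I_K => a%:R : R) k.
Proof.
move=> ku kt; apply: lis_length_order => i j.
by rewrite ler_nat (cell_order ku kt).
Qed.

Hypothesis X_indep : mutually_independent X.
Hypothesis X_unif : forall i, uniform01 (X i).

Lemma probability_cell k : P (cell k) = ((K ^ N)%:R^-1)%:E.
Proof.
rewrite /cell (X_indep (A := fun i => bucket K (tnth k i))); last first.
  by move=> i _; exact: measurable_bucket.
under eq_bigr => i _.
  rewrite [P _](_ : _ = (K%:R^-1)%:E).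
    over.
  have := X_unif i (measurable_bucket K (tnth k i)).
  by rewrite uniform_prob_bucket.
by rewrite prodEFin big_const cardsT card_ord iter_mulr_1 natrX exprVn.
Qed.

Lemma probability_cells (S : {set N.-tuple 'I_K}) :
  P (\bigcup_(k in [set` S]) cell k) = (#|S|%:R / (K ^ N)%:R)%:E.
Proof.
rewrite measure_fin_bigcup; [|exact: finite_finset|exact: trivIset_cell|].
  rewrite -(@bigfs _ _ _ _ (index_enum _)) ?index_enum_uniq//; last first.
    by move=> k _; rewrite mem_index_enum.
  rewrite (eq_bigr (fun=> ((K ^ N)%:R^-1)%:E)) => [|k _]; last exact: probability_cell.
  by rewrite sumEFin sumr_const mulr_natl.
by move=> k _; exact: measurable_cell.
Qed.

(* Outside an event of probability at most [N ^ 2 / K] the variables lie in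
   distinct buckets, and then the bucket indices are ordered as the variables. *)
Lemma probability_lis_le (D : set nat) :
  (P [set t | D (lis_length (fun i => X i t))] <=
  (#|[set k : N.-tuple 'I_K | `[< D (tuple_lis (fun a : 'I_K => a%:R : R) k) >]]%SET|%:R
     / (K ^ N)%:R + (N ^ 2)%:R / K%:R)%:E)%E.
Proof.
set S := [set k | _]%SET; set U := [set k : N.-tuple 'I_K | uniq k]%SET.
have mS (S' : {set N.-tuple 'I_K}) : measurable (\bigcup_(k in [set` S']) cell k).
  apply: fin_bigcup_measurable => [|k _]; first exact: finite_finset.
  exact: measurable_cell.
apply: (@le_trans _ _ (P (\bigcup_(k in [set` S]) cell k `|`
   ~` \bigcup_(k in [set` U]) cell k))).
  apply: le_measure; rewrite ?inE.
  - apply: measurable_order_invariant => t t' tt' /=.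
    by rewrite (lis_length_order tt').
  - by apply: measurableU => //; exact: measurableC.
  move=> t /= Dt; have [[k]|] := pselect ((\bigcup_(k in [set` U]) cell k) t).
    rewrite /= inE => ku kt; left; exists k => //=.
    by rewrite inE; apply/asboolP; rewrite -(lis_length_cell ku kt).
  by move=> Ut; right.
apply: (le_trans (measureU2 _ (mS _) (measurableC (mS _)))).
rewrite [leLHS](_ : _ = P (\bigcup_(k in [set` S]) cell k) +
    (1 - P (\bigcup_(k in [set` U]) cell k)))%E; last first.
  by congr (_ + _)%E; exact: probability_setC.
rewrite !probability_cells -EFinB -EFinD lee_fin lerD2l.
have -> : #|U| = (K ^_ N)%N.
  rewrite -[K in RHS]card_ord -card_uniq_tuples; apply: eq_card => k.
  by rewrite !inE all_predT.
by have := @ffact_ge_expn R N K K_gt0; lra.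
Qed.

End Cells.

(** * Passage to the limit and the deviation bounds *)

Section LisConcentration.
Context {d : measure_display} {T : measurableType d} {R : realType}.
Context (P : probability T R) (N : nat) (X : 'I_N -> {RV P >-> R}).
Hypothesis X_indep : mutually_independent X.
Hypothesis X_unif : forall i, uniform01 (X i).

Let L t : R := (lis_length (fun i => X i t))%:R.

Lemma measurable_lis_length (D : set R) : measurable [set t | D (L t)].
Proof.
apply: (measurable_order_invariant (X := X)) => t t' tt' /=.
by rewrite /L (lis_length_order tt').
Qed.

Lemma lis_length_concentration (a b : R) : 0 <= a -> a < b ->
  fine (P [set t | L t <= a]) * fine (P [set t | b <= L t]) <=
  expR (- ((b - a) ^+ 2 / (4 * b))).
Proof.
move=> a0 ab; set e := expR _.
have mD := measurable_lis_length.
have := fin_num_measure P _ (mD [set x | x <= a]).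
have := fin_num_measure P _ (mD [set x | b <= x]).
have := probability_le1 P (mD [set x | b <= x]).
have := measure_ge0 P [set t | b <= L t].
rewrite /=; set PB := P [set t | b <= L t]; set PA := P [set t | L t <= a].
move=> PB0 PB1 PBf PAf.
have {PB0}q0 : 0 <= fine PB by rewrite fine_ge0.
have {PB1}q1 : fine PB <= 1 by rewrite -lee_fin fineK.
(* Each probability exceeds its discrete analogue by at most [N ^ 2 / K]; as [al] and [fine PB] are
   at most 1, the product loses at most twice that. *)
have step K : (0 < K)%N -> fine PA * fine PB <= e + 2 * (N ^ 2)%:R / K%:R.
  move=> K0; set phi := fun i : 'I_K => i%:R : R.
  have PAle := probability_lis_le K0 X_indep X_unif [set m | m%:R <= a].
  have PBle := probability_lis_le K0 X_indep X_unif [set m | b <= m%:R].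
  rewrite /= -/PA -(fineK PAf) lee_fin in PAle.
  rewrite /= -/PB -(fineK PBf) lee_fin in PBle.
  move: PAle PBle; rewrite -/phi.
  set SA := [set k | _]%SET; set SB := [set k | `[< b <= _ >]]%SET => PAle PBle.
  have := tuple_lis_concentration phi (N := N) a0 ab.
  rewrite card_ord -/e.
  have -> : #|[set x : N.-tuple 'I_K | (tuple_lis phi x)%:R <= a]%SET| = #|SA|.
    by apply: eq_card => k; rewrite !inE asboolb.
  have -> : #|[set x : N.-tuple 'I_K | b <= (tuple_lis phi x)%:R]%SET| = #|SB|.
    by apply: eq_card => k; rewrite !inE asboolb.
  have KN0 : 0 < (K ^ N)%:R :> R by rewrite ltr0n expn_gt0 K0.
  rewrite [leRHS]mulrC -ler_pdivrMr ?exprn_gt0//.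
  rewrite [leLHS](_ : _ = (#|SA|%:R / (K ^ N)%:R) * (#|SB|%:R / (K ^ N)%:R)); last first.
    by field; rewrite gt_eqF.
  move: PAle PBle; set al := _ / _; set ep := _ / _; set be := _ / (K ^ N)%:R.
  move=> PAle PBle albe.
  have al0 : 0 <= al by rewrite divr_ge0 ?ler0n.
  have al1 : al <= 1.
    rewrite ler_pdivrMr// mul1r ler_nat (leq_trans (max_card _))//.
    by rewrite card_tuple card_ord.
  have ep0 : 0 <= ep by rewrite divr_ge0 ?ler0n.
  rewrite -mulrA -/ep; nra.
apply/ler_addgt0Pr => x x0.
have c0 : 0 <= 2 * (N ^ 2)%:R / x :> R by apply: divr_ge0 => //; exact: ltW.
have := archi_boundP c0; set K := Num.Def.archi_bound _ => cK.
have K0 : (0 < K)%N by rewrite -(ltr0n R) (le_lt_trans c0).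
apply: (le_trans (step _ K0)); rewrite lerD2l.
rewrite ler_pdivrMr ?ltr0n// [leRHS]mulrC -ler_pdivrMr//; exact: ltW.
Qed.

End LisConcentration.

Theorem theorem7p1p2 (R : realType) (d : measure_display)
    (T : measurableType d) (P : probability T R) (N : nat)
    (X : 'I_N -> {RV P >-> R}) (M : R) :
  mutually_independent X ->
  (forall i, uniform01 (X i)) ->
  let L : T -> R := fun t => (lis_length (fun i => X i t))%:R in
  is_median P L M ->
  forall u : R, 0 < u ->
    (P [set t | M + u <= L t]%R <=
       (2 * expR (- (u ^+ 2 / (4 * (M + u)))))%:E)%E /\
    (P [set t | L t <= M - u]%R <=
       (2 * expR (- (u ^+ 2 / (4 * M))))%:E)%E.
Proof.
move=> X_indep X_unif L [PleM PgeM] u u0.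
have mL := measurable_lis_length X.
have fL D := fin_num_measure P _ (mL D).
have conc a b := lis_length_concentration X_indep X_unif (a := a) (b := b).
have empty_lt0 a : a < 0 -> [set t | L t <= a] = set0.
  by move=> a0; rewrite -subset0 => t /= /le_lt_trans/(_ a0); rewrite ltNge ler0n.
(* The event [L <= M] has probability at least 1/2, so it is not empty, while [L] is nonnegative. *)
have M0 : 0 <= M.
  rewrite leNgt; apply/negP => /empty_lt0 M0; move: PleM.
  by rewrite M0 measure0 lee_fin leNgt invr_gt0 ltr0n.
have half (D : set R) : ((2^-1)%:E <= P [set t | D (L t)])%E ->
    2^-1 <= fine (P [set t | D (L t)]).
  by move=> h; rewrite -lee_fin (fineK (fL D)).
have fine_ge0P (D : set R) : 0 <= fine (P [set t | D (L t)]) by rewrite fine_ge0.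
split.
  have := half [set x | x <= M] PleM; have := fine_ge0P [set x | M + u <= x].
  have := conc M (M + u) M0; rewrite ltrDl => /(_ u0).
  rewrite (addrAC M) subrr add0r => h p0 q2.
  rewrite -(fineK (fL [set x | M + u <= x])) lee_fin/=; nra.
(* The product bound requires a nonnegative lower level; below 0 the event is empty. *)
have [Mu|Mu] := ltP (M - u) 0.
  by rewrite empty_lt0// measure0 lee_fin mulr_ge0 ?expR_ge0.
have := half [set x | M <= x] PgeM; have := fine_ge0P [set x | x <= M - u].
have := conc (M - u) M Mu; rewrite ltrBlDr ltrDl subKr => /(_ u0) h p0 q2.
rewrite -(fineK (fL [set x | x <= M - u])) lee_fin/=; nra.
Qed.
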